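(* Let $T$ be a tree on $n$ nodes labeled from an alphabet of size $\sigma$. Then the top DAG obtained by the modified top tree construction algorithm described in the context, with parameter $\alpha=10/9$, has size $O\!\left(\frac{n}{\log_\sigma n}\right)$.
   Context: Trees are rooted and ordered, with node labels from an alphabet $\Sigma$. For a node $v$ with children $v_1,\dots,v_k$, $T(v)$ is the subtree rooted at $v$, $F(v)=T(v_1)\cup\dots\cup T(v_k)$, and $T(v,v_s,v_r)=\{v\}\cup T(v_s)\cup\dots\cup T(v_r)$. A cluster is either $T(v,v_s,v_r)$ (top boundary node $v$) or $T(v,v_s,v_r)\setminus F(u)$ for $u\in T(v,v_s,v_r)\setminus\{v\}$ (top boundary $v$, bottom boundary $u$). Two edge-disjoint clusters sharing exactly one boundary node whose union is a cluster can be merged into the union; there are five possible types of such merges. The size of a cluster is the number of edges of $T$ it contains. A top tree of $T$ is an ordered labeled binary tree whose nodes are clusters: the root is $T$; the leaves are the edges of $T$, a leaf for edge $(u,v)$ ($u$ the parent) labeled by (label of $u$, label of $v$); each internal node is the merge of its two children, labeled by the merge type (one of 5 labels), the left child being the cluster visited first in preorder of $T$. The original algorithm (Bille et al.) maintains an ordered tree $\widetilde T$, initially $T$, whose edges correspond to the current clusters; merging two edges of $\widetilde T$ merges the corresponding clusters and replaces them by one edge (a vertical merge of $(v_1,v_2),(v_2,v_3)$ removes $v_2$ and creates edge $(v_1,v_3)$; a horizontal merge of two sibling edges below $v$, one of which goes to a leaf, removes that leaf). One iteration of the original algorithm consists of: (1) Horizontal merges: for each node $v$ of $\widetilde T$ with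 $k\ge2$ children $v_1,\dots,v_k$, for $i=1,\dots,\lfloor k/2\rfloor$ merge $(v,v_{2i-1})$ and $(v,v_{2i})$ if $v_{2i-1}$ or $v_{2i}$ is a leaf; if $k$ is odd, $v_k$ is a leaf and $v_{k-2},v_{k-1}$ are non-leaves, also merge $(v,v_{k-1})$ and $(v,v_k)$. (2) Vertical merges: for each maximal path $v_1,\dots,v_p$ with $v_{i+1}$ the parent of $v_i$ and $v_2,\dots,v_{p-1}$ having a single child: if $p$ is even merge consecutive pairs $\{(v_1,v_2),(v_2,v_3)\},\{(v_3,v_4),(v_4,v_5)\},\dots$ up to the edge $(v_{p-2},v_{p-1})$; if $p$ is odd merge consecutive pairs up to the edge $(v_{p-3},v_{p-2})$, and if $(v_{p-1},v_p)$ was not merged in step (1) also merge $\{(v_{p-2},v_{p-1}),(v_{p-1},v_p)\}$. The modified algorithm with parameter $\alpha>1$: for $t=1,2,\dots$ (until a single cluster remains), in the $t^\text{th}$ iteration it computes all merges that one iteration of the original algorithm (both steps) would perform on the current $\widetilde T$, and applies only those merges in which both participating clusters have size at most $\alpha^t$. The recorded merges form a top tree $\mathcal T$ of $T$; the top DAG is the minimal DAG representation of $\mathcal T$ obtained by identifying identical (isomorphic as ordered labeled trees) subtrees, and its size is its number of nodes. *)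

(* Defs.v *)
From HB Require Import structures.
From mathcomp Require Import all_boot all_order all_algebra.
From mathcomp Require Import reals exp.

Set Implicit Arguments.
Unset Strict Implicit.
Unset Printing Implicit Defensive.

Import Order.TTheory GRing.Theory Num.Theory.

(** * Rooted ordered labeled trees *)

Inductive tree (S : Type) : Type := Node of S & seq (tree S).

Definition root_label S (T : tree S) : S := let: Node a _ := T in a.

Fixpoint nb_nodes S (T : tree S) : nat :=
  let: Node _ ts := T in (sumn (map (@nb_nodes S) ts)).+1.

(** * Top trees *)

(** The five types of merges.  A vertical merge always consumes the bottom
    boundary node of the upper cluster; the type records whether the lower
    cluster has one.  In a horizontal merge at most one of the two clusters
    has a bottom boundary node. *)
Inductive merge_type : Type :=
  | VertBottom      (* the lower cluster has a bottom boundary node *)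
  | VertNoBottom    (* it does not *)
  | HorizLeft       (* only the left cluster has a bottom boundary node *)
  | HorizRight      (* only the right cluster has a bottom boundary node *)
  | HorizNone.      (* neither cluster has a bottom boundary node *)

(** A leaf is an edge of [T], labeled by (label of the parent, label of the
    child); in [TMerge m l r], [l] is the cluster visited first in preorder. *)
Inductive toptree (S : Type) : Type :=
  | TLeaf of S * S
  | TMerge of merge_type & toptree S & toptree S.

(** Leaves are pairwise distinct edges of [T], so this is the number of edges
    of [T] in the cluster at the root of [tt]. *)
Fixpoint cluster_size S (tt : toptree S) : nat :=
  match tt with
  | TLeaf _ => 1
  | TMerge _ l r => cluster_size l + cluster_size r
  end.

Fixpoint subtrees S (tt : toptree S) : seq (toptree S) :=
  tt :: match tt with
        | TLeaf _ => [::]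
        | TMerge _ l r => subtrees l ++ subtrees r
        end.

Definition merge_code (m : merge_type) : nat :=
  match m with
  | VertBottom => 0 | VertNoBottom => 1
  | HorizLeft => 2 | HorizRight => 3 | HorizNone => 4
  end.

Definition merge_decode (n : nat) : merge_type :=
  match n with
  | 0 => VertBottom | 1 => VertNoBottom
  | 2 => HorizLeft | 3 => HorizRight | _ => HorizNone
  end.

Fixpoint toptree_code S (tt : toptree S) : GenTree.tree (S * S) :=
  match tt with
  | TLeaf p => GenTree.Leaf p
  | TMerge m l r =>
      GenTree.Node (merge_code m) [:: toptree_code l; toptree_code r]
  end.

Fixpoint toptree_decode S (g : GenTree.tree (S * S)) : option (toptree S) :=
  match g with
  | GenTree.Leaf p => Some (TLeaf p)
  | GenTree.Node k [:: a; b] =>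
      match toptree_decode a, toptree_decode b with
      | Some l, Some r => Some (TMerge (merge_decode k) l r)
      | _, _ => None
      end
  | _ => None
  end.

Lemma toptree_codeK S : pcancel (@toptree_code S) (@toptree_decode S).
Proof. by elim=> [//|m l IHl r IHr] /=; rewrite IHl IHr; case: m. Qed.

HB.instance Definition _ (S : eqType) :=
  Equality.copy (toptree S) (pcan_type (@toptree_codeK S)).

(** Number of nodes of the minimal DAG of [tt]: its nodes are the subtrees of
    [tt] up to isomorphism of ordered labeled trees, i.e. up to [=]. *)
Definition topdag_size (S : eqType) (tt : toptree S) : nat :=
  size (undup (subtrees tt)).

(** * The auxiliary tree of clusters *)

(** The ordered tree written T with a tilde in the literature.  An edge is
    a pair (cluster, tree below its lower endpoint), the cluster being given by
    the top tree recorded for it; the node labels of [T] are only needed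
    in the labels of the top tree leaves.  The cluster of an edge has a bottom
    boundary node exactly when the lower endpoint of the edge is not a leaf. *)
Inductive ctree (S : Type) : Type := CNode of seq (toptree S * ctree S).

Definition is_cleaf S (t : ctree S) : bool :=
  let: CNode es := t in nilp es.

Fixpoint init_ctree S (T : tree S) : ctree S :=
  let: Node a ts := T in
  CNode [seq (TLeaf (a, root_label s), init_ctree s) | s <- ts].

(** The decomposition of a [ctree] into maximal paths [v_1, ..., v_p], where
    [v_(i+1)] is the parent of [v_i] and [v_2, ..., v_(p-1)] have one child.
    [PNode] stands for the root or a node whose number of children is not 1.
    It has one item [(e_1, [:: e_2; ...; e_(p-1)], below)] per child, for the
    maximal path through the edge to this child, where [e_i] is the cluster
    of the edge [(v_i, v_(i+1))] (so the last one is the edge to this child),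
    and [below] describes [v_1]. *)
Inductive ptree (S : Type) : Type :=
  PNode of seq (toptree S * seq (toptree S) * ptree S).

Fixpoint max_paths S (t : ctree S) : ptree S :=
  let: CNode es := t in
  PNode [seq match max_paths e.2 with
             | PNode [:: (e1, es1, below)] => (e1, rcons es1 e.1, below)
             | below => (e.1, [::], below)
             end | e <- es].

(** * One iteration *)

(** [leaf] is the list telling which of the [k] children of a node are leaves.
    [hmark leaf i] tells that step (1) merges the edges to the children
    [v_(i+1)] and [v_(i+2)], i.e. the children with 0-based positions [i] and
    [i.+1]. *)
Definition hmark (leaf : seq bool) (i : nat) : bool :=
  let k := size leaf in
  let lf j := nth false leaf j in
  [&& ~~ odd i, i.+1 < k & lf i || lf i.+1]
  || [&& odd k, 2 < k, i == k - 2, lf (k - 1), ~~ lf (k - 3) & ~~ lf (k - 2)].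

Definition hmerged (leaf : seq bool) (i : nat) : bool :=
  hmark leaf i || (0 < i) && hmark leaf i.-1.

Section Iteration.

Variable S : Type.

(** The merge of two clusters, when prescribed by the original algorithm, is
    applied only if [ok] holds. *)
Variable ok : toptree S -> toptree S -> bool.

(** The edge [c2] is just above the edge [c1], below which [t] hangs. *)
Definition vmerge (c2 c1 : toptree S) (t : ctree S) : toptree S * ctree S :=
  if ok c2 c1
  then (TMerge (if is_cleaf t then VertNoBottom else VertBottom) c2 c1, t)
  else (c2, CNode [:: (c1, t)]).

(** Step (2) on the maximal path with edges [e1 :: es], listed bottom-up, below
    which [t] hangs; [top_merged] tells that the topmost edge is merged in
    step (1).  The result is the edge remaining below the top node. *)
Fixpoint contract_path (top_merged : bool) (t : ctree S) (e1 : toptree S)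
    (es : seq (toptree S)) : toptree S * ctree S :=
  match es with
  | [::] => (e1, t)
  | [:: e2] => if top_merged then (e2, CNode [:: (e1, t)]) else vmerge e2 e1 t
  | e2 :: e3 :: es' =>
      contract_path top_merged (CNode [:: vmerge e2 e1 t]) e3 es'
  end.

(** The edges [e], [e'] go to consecutive siblings, one of which is a leaf. *)
Definition hmerge (e e' : toptree S * ctree S) : seq (toptree S * ctree S) :=
  if ok e.1 e'.1 then
    [:: match is_cleaf e.2, is_cleaf e'.2 with
        | true, true => (TMerge HorizNone e.1 e'.1, e.2)
        | true, false => (TMerge HorizRight e.1 e'.1, e'.2)
        | false, _ => (TMerge HorizLeft e.1 e'.1, e.2)
        end]
  else [:: e; e'].

(** Step (1) on the edges [es] to the children at positions [i], [i.+1], ... *)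
Fixpoint contract_siblings (leaf : seq bool) (i : nat)
    (es : seq (toptree S * ctree S)) : seq (toptree S * ctree S) :=
  match es with
  | e :: ((e' :: es') as es1) =>
      if hmark leaf i then hmerge e e' ++ contract_siblings leaf i.+2 es'
      else e :: contract_siblings leaf i.+1 es1
  | _ => es
  end.

(** All the merges are determined by the tree at the start of the iteration,
    and they involve pairwise disjoint pairs of edges.  Paths are contracted
    before siblings are, but since [contract_path] does not touch the topmost
    edge when it is merged in step (1), the two contractions do not
    interfere. *)
Fixpoint contract (p : ptree S) : ctree S :=
  let: PNode ps := p in
  let leaf :=
    [seq nilp q.1.2 && (if q.2 is PNode [::] then true else false) | q <- ps] in
  let below := [seq (q.1, contract q.2) | q <- ps] in
  let edges := [seq contract_path (hmerged leaf iq.1) iq.2.2 iq.2.1.1 iq.2.1.2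
               | iq <- zip (iota 0 (size below)) below] in
  CNode (contract_siblings leaf 0 edges).

Definition iteration (t : ctree S) : ctree S := contract (max_paths t).

End Iteration.

Local Open Scope ring_scope.

(** * The modified algorithm *)

Definition small_enough (R : numDomainType) S (alpha : R) (t : nat)
    (c c' : toptree S) : bool :=
  ((cluster_size c)%:R <= alpha ^+ t) && ((cluster_size c')%:R <= alpha ^+ t).

(** The tree of clusters after iterations [1, ..., t]. *)
Fixpoint modified_state (R : numDomainType) S (alpha : R) (T : tree S)
    (t : nat) : ctree S :=
  if t is t'.+1
  then iteration (small_enough alpha t) (modified_state alpha T t')
  else init_ctree T.

(** The algorithm stops with a single cluster, whose top tree is [tt] (further
    iterations would not change anything). *)
Definition modified_top_tree (R : numDomainType) S (alpha : R) (T : tree S)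
    (tt : toptree S) : Prop :=
  exists t, modified_state alpha T t = CNode [:: (tt, CNode [::])].

Definition logb (R : realType) (b x : R) : R := ln x / ln b.

(* Main.v *)
Require Import Defs.
From mathcomp Require Import all_boot all_order all_algebra.
From mathcomp Require Import reals exp.
From mathcomp Require Import zify ring lra.

(** Ignoring the size restriction, one iteration performs a constant fraction
    of merges: a tree of clusters with [m] edges admits at least [(m - 1) / 8]
    merges.  There are at most [n / alpha ^ t] clusters larger than [alpha ^ t],
    each blocking at most one merge, and [7 / 8 * 10 / 9 < 1], so that the
    number of clusters after [t] iterations is at most
    [36 n / alpha ^ t + 1], and all of them have size at most [2 alpha ^ t].
    Choose [t] with [2 alpha ^ t] close to [k = log_sigma n / 16].  Every
    subtree of the top tree with more than [k] leaves is created after iteration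
    [t] by a merge that decreases the number of clusters, so there are
    [O(n / k)] of them; the subtrees with at most [k] leaves have at most
    [sigma ^ (8 k) <= sqrt n] isomorphism types. *)

Set Implicit Arguments.
Unset Strict Implicit.
Unset Printing Implicit Defensive.

(** * Nested inductions and weights of cluster trees *)

Lemma tree_nested_ind S (P : tree S -> Prop) :
  (forall a ts, foldr (fun s A => P s /\ A) True ts -> P (Node a ts)) ->
  forall T, P T.
Proof.
move=> IH; fix F 1; case=> a ts; apply: IH.
by elim: ts => [//|s ts IHts] /=; split; [apply: F | exact: IHts].
Qed.

Lemma ctree_nested_ind S (P : ctree S -> Prop) :
  (forall es, foldr (fun e A => P e.2 /\ A) True es -> P (CNode es)) ->
  forall t, P t.
Proof.
move=> IH; fix F 1; case=> es; apply: IH.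
by elim: es => [//|[c t] es IHes] /=; split; [apply: F | exact: IHes].
Qed.

Lemma ptree_nested_ind S (P : ptree S -> Prop) :
  (forall ps, foldr (fun q A => P q.2 /\ A) True ps -> P (PNode ps)) ->
  forall p, P p.
Proof.
move=> IH; fix F 1; case=> ps; apply: IH.
by elim: ps => [//|[c p] ps IHps] /=; split; [apply: F | exact: IHps].
Qed.

(** One sum serves every count: [f] is constant 1 for all clusters, an indicator for some of them,
    [cluster_size] for the total size. *)
Fixpoint cweight S (f : toptree S -> nat) (t : ctree S) : nat :=
  let: CNode es := t in sumn [seq f e.1 + cweight f e.2 | e <- es].

Definition path_weight S (f : toptree S -> nat)
    (q : toptree S * seq (toptree S)) : nat :=
  f q.1 + sumn (map f q.2).

Fixpoint pweight S (f : toptree S -> nat) (p : ptree S) : nat :=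
  let: PNode ps := p in
  sumn [seq path_weight f q.1 + pweight f q.2 | q <- ps].

Lemma pweight_max_paths S (f : toptree S -> nat) t :
  pweight f (max_paths t) = cweight f t.
Proof.
elim/ctree_nested_ind: t => es; elim: es => [//|[c t] es IHes] /= [IHt /IHes].
rewrite /= => ->; congr (_ + _).
rewrite -IHt /path_weight.
case: (max_paths t) => [[|[[e1 es1] below] [|? ?]]] //=; rewrite ?addn0 //.
by rewrite map_rcons sumn_rcons /path_weight /=; lia.
Qed.

(** With [g] an indicator, weight 0 excludes the clusters where [g] holds, so the comparison is
    needed at the others only. *)
Lemma cweight_leq S (g f f' : toptree S -> nat) t :
  (forall c, g c = 0 -> f c <= f' c) -> cweight g t = 0 ->
  cweight f t <= cweight f' t.
Proof.
move=> ff'; elim/ctree_nested_ind: t => es.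
elim: es => [//|[c t] es IHes] /= [IHt /IHes] /= IH g0.
by rewrite !leq_add ?ff' ?IHt ?IH //; lia.
Qed.

Lemma cweight0 S (t : ctree S) : cweight (fun=> 0) t = 0.
Proof.
by elim/ctree_nested_ind: t; elim=> [|[c t] es IHes] //= [-> /IHes].
Qed.

(** * The merges planned by one iteration *)

(** The number of step (2) merges prescribed on a path with [n.+1] edges, [tm]
    telling that its topmost edge is merged in step (1). *)
Definition vplan (tm : bool) (n : nat) : nat := if tm then n./2 else uphalf n.

Definition leaf_paths S (ps : seq (toptree S * seq (toptree S) * ptree S)) :
    seq bool :=
  [seq nilp q.1.2 && (if q.2 is PNode [::] then true else false) | q <- ps].

Definition hplan (leaf : seq bool) : nat :=
  count (hmark leaf) (iota 0 (size leaf)).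

Fixpoint pplan S (p : ptree S) : nat :=
  let: PNode ps := p in
  let leaf := leaf_paths ps in
  let below := [seq (q.1, pplan q.2) | q <- ps] in
  hplan leaf +
  sumn [seq vplan (hmerged leaf iq.1) (size iq.2.1.2) + iq.2.2
       | iq <- zip (iota 0 (size below)) below].

Lemma hmark_lt leaf i : hmark leaf i -> i.+1 < size leaf.
Proof.
by rewrite /hmark => /orP[/and3P[_ ? _]//|/and5P[_ ? /eqP ? _ _]]; lia.
Qed.

(** Regular pairs start at even positions. The extra pair starts at [k - 2] for odd [k] and could
    only overlap the regular pair at [k - 3], which contains no leaf. *)
Lemma hmark_disjoint leaf i : hmark leaf i -> ~~ hmark leaf i.+1.
Proof.
rewrite /hmark => H; apply/negP => H'; move: H H'.
set k := size leaf.
case/orP=> [/and3P[ev lt1 lf1]|/and5P[ok k2 /eqP ik _ _]];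
  case/orP=> [/and3P[ev' lt1' lf1']|/and5P[ok' k2' /eqP ik' _ /andP[n3 n2]]].
- by move: ev ev' => /=; rewrite negbK => /negP.
- have e3 : k - 3 = i by lia.
  by move: lf1 n3 n2; rewrite -ik' e3 => /orP[]->.
- by lia.
- by lia.
Qed.

(** * Change of a weight under one iteration *)

Section Potential.

Variables (S : Type) (ok : toptree S -> toptree S -> bool).
(** Each planned merge should lower the weight [f] by [d], up to the allowances [b] of its two
    clusters, which cover [d] when the merge is blocked. Planned pairs are disjoint, so no allowance
    is spent twice. *)
Variables (f b : toptree S -> nat) (d : nat).
Hypothesis merge_ok : forall m l r,
  ok l r -> f (TMerge m l r) + d <= f l + f r + (b l + b r).
Hypothesis merge_ko : forall l r, ~~ ok l r -> d <= b l + b r.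

Lemma vmerge_weight c2 c1 t (r := vmerge ok c2 c1 t) :
  f r.1 + cweight f r.2 + d <= f c2 + f c1 + (b c2 + b c1) + cweight f t.
Proof.
rewrite /r /vmerge; case: ifPn => [H|/merge_ko H] /=; last by lia.
by have := merge_ok (if is_cleaf t then VertNoBottom else VertBottom) H; lia.
Qed.

(** When the topmost edge is merged in step (1), its allowance [b] is kept for
    that merge. *)
Lemma contract_path_weight tm t e1 es (r := contract_path ok tm t e1 es) :
  f r.1 + cweight f r.2 + d * vplan tm (size es)
    + tm * b (last e1 es)
  <= cweight f t + path_weight f (e1, es) + path_weight b (e1, es).
Proof.
rewrite {}/r /path_weight /=.
have [n] := ubnP (size es).
elim: n => // n IHn in t e1 es *; case: es => [|e2 [|e3 es]] /= lt_n.
- by rewrite /vplan /=; case: tm {IHn}; lia.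
- case: tm {IHn} => /=; [|have := vmerge_weight e2 e1 t].
    by rewrite /vplan /=; lia.
  by rewrite /vplan /=; lia.
- have := IHn (CNode [:: vmerge ok e2 e1 t]) e3 es.
  have := vmerge_weight e2 e1 t; move: (vmerge ok e2 e1 t) => v /=.
  have -> : vplan tm (size es).+2 = (vplan tm (size es)).+1.
    by rewrite /vplan; case: tm {IHn}.
  rewrite mulnS; move: (d * vplan _ _) => x ? /(_ ltac:(lia)); lia.
Qed.

(** Step (1) thus spends exactly the allowance that the path kept for it. *)
Lemma contract_path_top t e1 es :
  (contract_path ok true t e1 es).1 = last e1 es.
Proof.
have [n] := ubnP (size es).
elim: n => // n IHn in t e1 es *; case: es => [|e2 [|e3 es]] //= lt_n.
by apply: IHn; lia.
Qed.

Definition eweight (e : toptree S * ctree S) := f e.1 + cweight f e.2.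

Lemma cweightE es : cweight f (CNode es) = sumn (map eweight es).
Proof. by []. Qed.

Lemma hmerge_weight e e' :
  sumn (map eweight (hmerge ok e e')) + d
    <= eweight e + eweight e' + (b e.1 + b e'.1).
Proof.
rewrite /hmerge; case: ifPn => [H|/merge_ko H]; last by rewrite /=; lia.
rewrite /eweight; case: e H => [c [[|x es]]]; case: e' => [c' [[|x' es']]] /= H.
- by have := merge_ok HorizNone H; lia.
- by have := merge_ok HorizRight H; lia.
- by have := merge_ok HorizLeft H; lia.
- by have := merge_ok HorizLeft H; lia.
Qed.

Lemma contract_siblings_weight leaf i es :
  ~~ ((0 < i) && hmark leaf i.-1) -> i + size es = size leaf ->
  sumn (map eweight (contract_siblings ok leaf i es))
    + d * count (hmark leaf) (iota i (size es))
  <= sumn (map eweight es)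
    + sumn [seq hmerged leaf ie.1 * b ie.2.1
           | ie <- zip (iota i (size es)) es].
Proof.
have [n] := ubnP (size es).
elim: n => // n IHn in i es *; case: es => [|e [|e' es]] lt_n Hi sz.
- by rewrite /= muln0.
- have /negPf Hm : ~~ hmark leaf i.
    by apply/negP => /hmark_lt; rewrite -sz /=; lia.
  by rewrite /= Hm /=; lia.
- have -> : contract_siblings ok leaf i [:: e, e' & es] =
     if hmark leaf i then hmerge ok e e' ++ contract_siblings ok leaf i.+2 es
      else e :: contract_siblings ok leaf i.+1 (e' :: es) by [].
  case: ifPn => Hm.
    have Hm1 := hmark_disjoint Hm.
    have := IHn i.+2 es; rewrite /= => /(_ _ Hm1) IH.
    rewrite /= in lt_n sz *.
    have -> : hmerged leaf i by rewrite /hmerged Hm.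
    have -> : hmerged leaf i.+1 by rewrite /hmerged /= Hm orbT.
    rewrite map_cat sumn_cat Hm (negPf Hm1).
    have := hmerge_weight e e'.
    move: IH => /(_ ltac:(lia) ltac:(lia)).
    move: (count _ _) => y; rewrite add0n mulnDr muln1; move: (d * y) => z.
    lia.
  have := IHn i.+1 (e' :: es).
  rewrite /= (negPf Hm) /= in lt_n sz * => /(_ _ isT).
  rewrite add0n; move=> /(_ ltac:(lia) ltac:(lia)).
  move: (d * _) => z; lia.
Qed.

Lemma contract_weight p :
  cweight f (contract ok p) + d * pplan p <= pweight f p + pweight b p.
Proof.
elim/ptree_nested_ind: p => ps IH.
rewrite [contract _ _]/= [pplan _]/= -/(leaf_paths ps).
set leaf := leaf_paths ps; rewrite !size_map.
set es := (X in contract_siblings _ _ _ X).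
have szes : size es = size ps.
  by rewrite /es size_map size_zip size_iota size_map minnn.
have := @contract_siblings_weight leaf 0 es isT.
rewrite /hplan szes size_map => /(_ erefl).
rewrite cweightE mulnDr.
(* The paths spend all allowances except those at positions merged in step (1). The start [i] is
   generalized for the induction on [ps], while [leaf] stays the whole list. *)
suff H i (es' := [seq
       contract_path ok (hmerged leaf iq.1) iq.2.2 iq.2.1.1 iq.2.1.2
       | iq <- zip (iota i (size ps)) [seq (q.1, contract ok q.2) | q <- ps]]) :
   sumn (map eweight es') + sumn [seq hmerged leaf ie.1 * b ie.2.1
           | ie <- zip (iota i (size ps)) es'] +
     d * sumn [seq vplan (hmerged leaf iq.1) (size iq.2.1.2) + iq.2.2
        | iq <- zip (iota i (size ps)) [seq (q.1, pplan q.2) | q <- ps]]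
     <= pweight f (PNode ps) + pweight b (PNode ps).
  have := H 0; rewrite -/es /=; lia.
rewrite {}/es' {szes es}.
move: leaf => leaf; elim: ps IH i => [|[[e1 es] p] ps IHps] /=.
  by rewrite !muln0.
case=> IHp /IHps {}IHps i; have /= := IHps i.+1.
move: (sumn _ ) (sumn _) (sumn _) (sumn _) (sumn _) => s1 s2 s3 s4 s5.
have := contract_path_weight (hmerged leaf i) (contract ok p) e1 es.
have := @contract_path_top (contract ok p) e1 es.
case: (hmerged leaf i) => [->//|_]; rewrite /eweight !mulnDr; lia.
Qed.

(** Instances: [d = 0] and [b = 0] for a potential that does not increase;
    [f = 1], [d = 1] and [b] the indicator of the clusters that may not be
    merged, for the number of clusters. *)
Lemma iteration_weight t :
  cweight f (iteration ok t) + d * pplan (max_paths t)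
    <= cweight f t + cweight b t.
Proof.
by rewrite -(pweight_max_paths f t) -(pweight_max_paths b t) contract_weight.
Qed.

End Potential.

(** * A lower bound on the number of planned merges *)

Definition nb_children S (p : ptree S) : nat :=
  let: PNode ps := p in size ps.

(** Maximality of the paths: one whose lower endpoint has a single child could be prolonged. *)
Fixpoint pbranching S (p : ptree S) : bool :=
  let: PNode ps := p in
  all (fun q => (nb_children q.2 != 1) && pbranching q.2) ps.

Lemma pbranching_max_paths S (t : ctree S) : pbranching (max_paths t).
Proof.
elim/ctree_nested_ind: t => es; elim: es => [//|[c t] es IHes] /= [IHt /IHes].
move=> /= ->; rewrite andbT; move: IHt.
by case: (max_paths t) => [[|[[e1 es1] below] [|? ?]]] //= /andP[->].
Qed.

Lemma hmerged_count leaf :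
  count (hmerged leaf) (iota 0 (size leaf)) <= 2 * hplan leaf.
Proof.
rewrite /hplan; move: (size leaf) => k; rewrite /hmerged.
apply: leq_trans (_ : count (hmark leaf) (iota 0 k) +
  count (fun i => (0 < i) && hmark leaf i.-1) (iota 0 k) <= _).
  by rewrite -count_predUI leq_addr.
rewrite mul2n -addnn leq_add2l.
case: k => // k; set P := fun i => _.
have -> : count P (iota 0 k.+1) = count (hmark leaf) (iota 0 k).
  by rewrite /= add0n -[1]/(1 + 0) iotaDl count_map.
by rewrite -addn1 iotaD count_cat leq_addr.
Qed.

(** The regular pair of an odd position always exists, that of an even one unless it is last, and a
    leaf makes the pair mergeable. *)
Lemma unmerged_leaf leaf i :
  nth false leaf i -> ~~ hmerged leaf i -> i.+1 = size leaf /\ ~~ odd i.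
Proof.
move=> li; have lt_i : i < size leaf.
  by case: ltnP => // /(nth_default false); rewrite li.
rewrite /hmerged negb_or /hmark li => /andP[].
have [od|ev] := boolP (odd i).
  case: i od li lt_i => //= i /negPf od li lt_i _.
  by rewrite od li lt_i orbT.
by move=> H _; split=> //; move: H; rewrite orTb; lia.
Qed.

(** Only the last of an odd number of siblings qualifies. Some merge is then planned: the pair just
    before it if that contains a leaf, the extra merge otherwise. *)
Lemma unmerged_leaf_count leaf : 1 < size leaf ->
  count (fun i => nth false leaf i && ~~ hmerged leaf i) (iota 0 (size leaf))
    <= hplan leaf.
Proof.
move=> k2; set P := fun i => _.
case: (boolP (has P (iota 0 (size leaf)))); last first.
  by rewrite has_count -leqNgt leqn0 => /eqP->.
move=> /hasP[i _ /andP[li mi]].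
have [ei evi] := unmerged_leaf li mi.
apply: leq_trans (_ : 1 <= _).
  apply: leq_trans (_ : count_mem i (iota 0 (size leaf)) <= 1); last first.
    by rewrite count_uniq_mem ?iota_uniq // leq_b1.
  apply: sub_count => j /andP[lj mj] /=; apply/eqP.
  by have [ej _] := unmerged_leaf lj mj; lia.
rewrite /hplan -has_count; apply/hasP.
have i2 : 1 < i by lia.
have lt_im : forall j, j <= i -> j \in iota 0 (size leaf).
  by move=> j; rewrite mem_iota; lia.
have [lf|/norP[l2 l1]] :=
  boolP (nth false leaf (i - 2) || nth false leaf (i - 1)).
  exists (i - 2); first by apply: lt_im; lia.
  have e : (i - 2).+1 = i - 1 by lia.
  by rewrite /hmark e lf; apply/orP; left; apply/and3P; split => //; lia.
exists (i - 1); first by apply: lt_im; lia.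
rewrite /hmark -ei; apply/orP; right.
have -> : i.+1 - 3 = i - 2 by lia.
have -> : i.+1 - 2 = i - 1 by lia.
have -> : i.+1 - 1 = i by lia.
by rewrite li l2 l1 eqxx !andbT; lia.
Qed.

Definition nb_edges S (p : ptree S) := pweight (fun=> 1) p.

(** Every maximal path is charged its edges plus 1, and pays with 8 per planned
    merge in it or below it.  The remaining deficit is at most 3 for a path
    whose topmost edge takes part in a step (1) merge, i.e. at most 6 out of the
    8 earned by that merge, and at most 2 for an unmerged leaf edge. *)
Lemma path_plan S (q : toptree S * seq (toptree S) * ptree S) tm :
  nb_children q.2 != 1 ->
  (1 < nb_children q.2 -> nb_edges q.2 + 2 <= 8 * pplan q.2) ->
  let leaf := nilp q.1.2 && (if q.2 is PNode [::] then true else false) in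
  path_weight (fun=> 1) q.1 + nb_edges q.2 + 1
    <= 8 * (vplan tm (size q.1.2) + pplan q.2) + 3 * tm + 2 * (leaf && ~~ tm).
Proof.
case: q => [[e1 es] p]; rewrite [(_, p).1]/= [(_, p).2]/= => k1 IH.
have -> : path_weight (fun=> 1) (e1, es) = (size es).+1.
  by rewrite /path_weight /=; elim: es => //= _ es ->.
rewrite /= /nilp /vplan.
(* Deficit 3 arises for two edges ending in a leaf, the upper one merged in step (1): no vertical
   merge is planned there. *)
have [->|] : p = PNode [::] \/ (nb_edges p + 2 <= 8 * pplan p).
  by case: p k1 IH => [] [|? [|? ?]] // _ IH; [left|right; exact: IH].
  by rewrite /nb_edges /= /hplan /=; case: tm => /=; lia.
move: (nb_edges p) (pplan p) (_ && ~~ tm) => E M lf.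
by case: tm => /=; lia.
Qed.

(** The marks depend on all siblings, so the induction runs over suffixes of a fixed [leaf]. *)
Lemma sibling_paths_plan S (ps : seq (toptree S * seq (toptree S) * ptree S))
    leaf i :
  leaf_paths ps = drop i leaf -> pbranching (PNode ps) ->
  foldr (fun q A => (pbranching q.2 -> 1 < nb_children q.2 ->
                      nb_edges q.2 + 2 <= 8 * pplan q.2) /\ A) True ps ->
  nb_edges (PNode ps) + size ps
  <= 8 * sumn [seq vplan (hmerged leaf iq.1) (size iq.2.1.2) + iq.2.2
              | iq <- zip (iota i (size ps)) [seq (q.1, pplan q.2) | q <- ps]]
     + 3 * count (hmerged leaf) (iota i (size ps))
     + 2 * count (fun j => nth false leaf j && ~~ hmerged leaf j)
             (iota i (size ps)).
Proof.
elim: ps i => [|q ps IHps] i //= Ei /andP[/andP[k1 br] brs] [IHq IH].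
have lt_i : i < size leaf.
  by case: ltnP Ei => // /drop_oversize->.
move: Ei; rewrite (drop_nth false lt_i) => -[Eq Ei].
move: IHps => /(_ i.+1 Ei brs IH); rewrite -Eq /=.
have := path_plan (hmerged leaf i) k1 (IHq br); rewrite /nb_edges /=.
by move: (vplan _ _) => v; lia.
Qed.

(** With [h] step (1) merges at the node, at most [2 * h] paths have deficit 3 and at most [h] have
    deficit 2, in total [8 * h]. The spare units of the two or more paths give the [+ 2]. *)
Lemma plan_lower_bound S (p : ptree S) :
  pbranching p -> 1 < nb_children p -> nb_edges p + 2 <= 8 * pplan p.
Proof.
elim/ptree_nested_ind: p => ps IH br k2.
have := sibling_paths_plan (leaf := leaf_paths ps) (esym (drop0 _)) br IH.
have := unmerged_leaf_count (leaf := leaf_paths ps).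
have := hmerged_count (leaf_paths ps).
rewrite size_map => h1 /(_ k2) h2 h3.
rewrite [pplan _]/= size_map -/(leaf_paths ps); move: k2 => /=; lia.
Qed.

Lemma plan_max_paths S (t : ctree S) :
  cweight (fun=> 1) t <= 8 * pplan (max_paths t) + 1.
Proof.
rewrite -pweight_max_paths -/(nb_edges _).
have := pbranching_max_paths t; case: (max_paths t) => ps br.
case: ps br => [|q [|q' ps]] br //; last first.
  by have := plan_lower_bound br isT; lia.
(* A root with one child has no step (1) merge: a deficit of at most 2 and one spare unit leave the
   [+ 1]. *)
have := sibling_paths_plan (leaf := leaf_paths [:: q]) (esym (drop0 _)) br.
move=> /(_ (conj (@plan_lower_bound _ _) I)) /=.
have -> l : hplan [:: l] = 0 by case: l.
by case: (nilp _ && _) => /=; lia.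
Qed.

(** * Effect of one iteration on the clusters *)

Lemma iteration_subadd S (ok : toptree S -> toptree S -> bool) f t :
  (forall m l r, ok l r -> f (TMerge m l r) <= f l + f r) ->
  cweight f (iteration ok t) <= cweight f t.
Proof.
move=> fM; have := @iteration_weight S ok f (fun=> 0) 0 _ _ t.
rewrite cweight0 mul0n !addn0; apply=> // m l r okH.
by rewrite !addn0 fM.
Qed.

Lemma iteration_shrink S (ok : toptree S -> toptree S -> bool)
    (small : pred (toptree S)) t :
  (forall c c', ok c c' = small c && small c') ->
  8 * cweight (fun=> 1) (iteration ok t)
    <= 7 * cweight (fun=> 1) t + 1 + 8 * cweight (fun c => ~~ small c) t.
Proof.
move=> okE; have := plan_max_paths t.
have := @iteration_weight S ok (fun=> 1) (fun c => ~~ small c) 1 _ _ t.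
rewrite mul1n => H H1; suff: 8 * (cweight (fun=> 1) (iteration ok t)
  + pplan (max_paths t)) <= 8 * (cweight (fun=> 1) t
  + cweight (fun c => ~~ small c) t) by lia.
rewrite leq_mul2l /=; apply: H => [m l r _|l r]; first by lia.
by rewrite okE; case: (small l); case: (small r).
Qed.

Lemma contract_siblings_nilp S (ok : toptree S -> toptree S -> bool) leaf i es :
  nilp (contract_siblings ok leaf i es) = nilp es.
Proof.
case: es => [|e [|e' es]] //=; case: ifP => // _.
by rewrite /hmerge; case: ifP.
Qed.

Lemma iteration_cleaf S (ok : toptree S -> toptree S -> bool) t :
  is_cleaf (iteration ok t) = is_cleaf t.
Proof.
case: t => es; rewrite /iteration [max_paths _]/=.
set ps := map _ _; rewrite [RHS]/=.
have <- : nilp ps = nilp es by rewrite /nilp size_map.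
by move: ps => ps; rewrite /= contract_siblings_nilp; case: ps.
Qed.

Lemma single_cluster S (t : ctree S) :
  ~~ is_cleaf t -> cweight (fun=> 1) t <= 1 ->
  exists tt, t = CNode [:: (tt, CNode [::])].
Proof.
case: t => [[|[tt [es]] es']] //= _.
case: es => [|e es]; last by rewrite /=; lia.
by case: es' => [|e es] /=; [exists tt | lia].
Qed.

Lemma cweight_init S (f : toptree S -> nat) (T : tree S) :
  (forall e, f (TLeaf e) = 1) -> (cweight f (init_ctree T)).+1 = nb_nodes T.
Proof.
move=> fL; elim/tree_nested_ind: T => a ts; elim: ts => [//|s ts IHts].
by case=> IHs /IHts /= [<-]; rewrite fL -IHs; congr _.+1; lia.
Qed.

Import Order.TTheory GRing.Theory Num.Theory.

(** * Cluster sizes after [t] iterations *)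

Section State.

Variables (R : realDomainType) (S : Type) (alpha : R) (T : tree S).
Hypothesis alpha_ge1 : (1 <= alpha)%R.
Notation state t := (modified_state alpha T t).

Lemma state_subadd f t :
  (forall m l r, small_enough alpha t.+1 l r ->
     f (TMerge m l r) <= f l + f r) ->
  cweight f (state t.+1) <= cweight f (state t).
Proof. exact: iteration_subadd. Qed.

Lemma state_subadd_le f t j :
  (forall m l r, f (TMerge m l r) <= f l + f r) ->
  cweight f (state (t + j)) <= cweight f (state t).
Proof.
move=> fM; elim: j => [|j IHj]; first by rewrite addn0.
by rewrite addnS (leq_trans (state_subadd _)).
Qed.

Lemma state_size t : cweight (@cluster_size S) (state t) < nb_nodes T.
Proof.
rewrite -(cweight_init T (f := @cluster_size S)) // ltnS.
exact: (@state_subadd_le _ 0).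
Qed.

Lemma state_cleaf t : 1 < nb_nodes T -> ~~ is_cleaf (state t).
Proof.
move=> T1; elim: t => [|t IHt]; last by rewrite /= iteration_cleaf.
by case: T T1 => a [].
Qed.

Lemma state_stable t j tt : state t = CNode [:: (tt, CNode [::])] ->
  state (t + j) = CNode [:: (tt, CNode [::])].
Proof. by move=> E; elim: j => [|j IHj]; rewrite ?addn0 // addnS /= IHj. Qed.

Definition big (A : R) (c : toptree S) : bool :=
  ~~ ((cluster_size c)%:R <= A)%R.

(** A merge applied in an iteration joins two clusters within its size limit; other clusters obey
    the previous, smaller bound. *)
Lemma big_state t : cweight (big (2 * alpha ^+ t)%R) (state t) = 0.
Proof.
elim: t => [|t IHt].
  rewrite /= expr0 mulr1; elim/tree_nested_ind: T => a ts.
  elim: ts => [//|s ts IHts] /= [-> /IHts /= ->].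
  by rewrite /big /= ler1n.
apply/eqP; rewrite -leqn0; apply: leq_trans (state_subadd _) _.
  move=> m l r /andP[sl sr]; rewrite [X in X <= _](_ : _ = 0) //; apply/eqP.
  by rewrite eqb0 negbK /= natrD mulr2n mulrDl mul1r lerD.
apply: leq_trans (_ : cweight (fun=> 0) (state t) <= 0); last first.
  by rewrite cweight0.
apply: cweight_leq IHt => c /eqP.
rewrite eqb0 negbK leqn0 eqb0 negbK => H; apply: le_trans H _.
by rewrite ler_wpM2l // ler_weXn2l.
Qed.

(** Markov's inequality for cluster sizes. *)
Lemma big_bound A t :
  ((cweight (big A) t)%:R * A <= (cweight (@cluster_size S) t)%:R)%R.
Proof.
elim/ctree_nested_ind: t => es.
elim: es => [|[c t] es IHes] /=; first by rewrite mul0r.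
case=> IHt /IHes /= {}IHes; rewrite !natrD !mulrDl !lerD // /big.
by case: (lerP _ A) => [_|/ltW] /=; rewrite ?mul0r ?mul1r ?ler0n.
Qed.

End State.

(** * Decay of the number of clusters, and termination *)

Section Rate.

Variables (R : realFieldType) (S : Type) (T : tree S).
Let alpha : R := (10 / 9)%R.
Notation state t := (modified_state alpha T t).
Notation m t := (cweight (fun=> 1) (state t)).
Local Open Scope ring_scope.

Lemma alpha_ge1 : 1 <= alpha. Proof. by rewrite /alpha; lra. Qed.

Lemma nb_clusters_shrink t (B := cweight (big (alpha ^+ t.+1)) (state t)) :
  (8 * m t.+1 <= 7 * m t + 1 + 8 * B)%N /\
  B%:R * alpha ^+ t.+1 <= (nb_nodes T)%:R.
Proof.
split; first exact: iteration_shrink.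
apply: le_trans (big_bound _ _) _.
by rewrite ler_nat ltnW // state_size.
Qed.

(** For [x t = (m t - 1) * alpha ^+ t] and [n] nodes, the recurrence reads
    [8 * x t.+1 <= 70 / 9 * x t + 8 * n], with fixed point [36 * n]. *)
Lemma nb_clusters_bound t :
  (m t)%:R * alpha ^+ t <= 36 * (nb_nodes T)%:R + alpha ^+ t.
Proof.
elim: t => [|t].
  have := cweight_init T (f := fun=> 1%N) (fun=> erefl).
  move=> /(congr1 (fun n : nat => n%:R : R)); rewrite -addn1 natrD.
  rewrite [modified_state _ _ _]/= expr0 mulr1.
  by have := ler0n R (nb_nodes T); lra.
case: (nb_clusters_shrink t).
move: (cweight (big _) _) => B.
rewrite -(ler_nat R) !natrD => sh Bn IH.
have a0 : 0 <= alpha ^+ t.+1 by rewrite exprn_ge0 // /alpha; lra.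
have := ler_wpM2r a0 sh; move: Bn IH.
have -> : alpha ^+ t = 9 / 10 * alpha ^+ t.+1 by rewrite exprS /alpha; lra.
move: (alpha ^+ t.+1) (m _)%:R (m _)%:R (B%:R) => a m1 m0 b'; nra.
Qed.

(** Bernoulli's inequality, used to find large powers of [alpha]. *)
Lemma alpha_expr_ge t : 1 + t%:R / 9 <= alpha ^+ t.
Proof.
elim: t => [|t IHt]; first by rewrite expr0; lra.
rewrite exprS -natr1; have := ler0n R t; move: IHt.
by move: (alpha ^+ t) => a; rewrite /alpha; lra.
Qed.

Lemma modified_terminates : (1 < nb_nodes T)%N ->
  exists tt, modified_top_tree alpha T tt.
Proof.
move=> T1.
(* From [t0] on, the size limit exceeds the number of nodes, so no cluster is blocked. *)
pose t0 := (9 * nb_nodes T)%N.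
have big0 t : (t0 <= t)%N -> cweight (big (alpha ^+ t.+1)) (state t) = 0%N.
  move=> t0t; apply/eqP; rewrite -leqn0 leqNgt; apply/negP => B0.
  have [_] := nb_clusters_shrink t; apply/negP; rewrite -ltNge.
  have H : (nb_nodes T)%:R < alpha ^+ t.+1.
    have := alpha_expr_ge t.+1; apply: lt_le_trans.
    have : (t0%:R : R) <= t.+1%:R by rewrite ler_nat ltnW.
    by rewrite natrM; lra.
  apply: lt_le_trans H _; rewrite ler_peMl ?ler1n //.
  by rewrite exprn_ge0 // /alpha; lra.
(* Without blocked clusters, [8 * m t.+1 <= 7 * m t + 1] is a strict decrease as long as
   [m t > 1]. *)
have dec j : (m (t0 + j) - 1 <= m t0 - j.+1)%N \/ (m (t0 + j) <= 1)%N.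
  elim: j => [|j IHj]; first by rewrite addn0; left.
  have [] := nb_clusters_shrink (t0 + j).
  by rewrite big0 ?leq_addr // (addnS t0) => H _; lia.
have [t Ht] : exists t, (m t <= 1)%N.
  by exists (t0 + m t0)%N; case: (dec (m t0)); lia.
have [tt Ett] := single_cluster (state_cleaf _ _ T1) Ht.
by exists tt, t.
Qed.

End Rate.

(** * Counting top trees with few leaves *)

Lemma merge_code_lt m : merge_code m < 5.
Proof. by case: m. Qed.

(** Polish notation: the fixed arities make it a prefix code. *)
Fixpoint preorder_code S (c : toptree S) : seq (S * S + 'I_5) :=
  match c with
  | TLeaf e => [:: inl e]
  | TMerge m l r =>
      inr (Ordinal (merge_code_lt m)) :: preorder_code l ++ preorder_code r
  end.

Lemma size_preorder_code S (c : toptree S) :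
  size (preorder_code c) < 2 * cluster_size c.
Proof. by elim: c => //= m l IHl r IHr; rewrite size_cat; lia. Qed.

(** The continuations [s], [s'] serve the induction and, later, the removal of padding. *)
Lemma preorder_code_prefix S (c c' : toptree S) s s' :
  preorder_code c ++ s = preorder_code c' ++ s' -> c = c' /\ s = s'.
Proof.
elim: c c' s s' => [e|m l IHl r IHr] [e'|m' l' r'] s s' //=.
  by case=> -> ->.
case=> Em; rewrite -!catA => /IHl[-> /IHr[-> ->]]; split=> //; congr TMerge.
by case: m m' Em => [] [].
Qed.

Lemma count_toptrees (Sigma : finType) (s : seq (toptree Sigma)) k :
  uniq s -> all (fun c => cluster_size c <= k) s ->
  size s <= (#|Sigma| ^ 2 + 5) ^ (2 * k).
Proof.
move=> us /allP sk.
pose tok : finType := (Sigma * Sigma + 'I_5)%type.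
(* Codes get the common length [2 * k]; by the prefix property any token can serve as padding. *)
pose pad (c : toptree Sigma) : (2 * k).-tuple tok :=
  [tuple nth (inr ord0) (preorder_code c) i | i < 2 * k].
have padE c : cluster_size c <= k ->
  preorder_code c ++ nseq (2 * k - size (preorder_code c)) (inr ord0) = pad c.
  move=> ck; have ltc := size_preorder_code c.
  apply: (@eq_from_nth _ (inr ord0)).
    by rewrite size_tuple size_cat size_nseq; lia.
  move=> i; rewrite size_cat size_nseq => lti.
  have lti' : i < 2 * k by lia.
  rewrite -(tnth_nth _ (pad c) (Ordinal lti')) tnth_mktuple /= nth_cat nth_nseq.
  case: ltnP => // le; rewrite nth_default //; by case: ifP.
have inj : {in s &, injective pad}.
  move=> c c' /sk ck /sk ck' E.
  have := padE _ ck; rewrite E -(padE _ ck').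
  by move=> /preorder_code_prefix[].
have := max_card [in map pad s]; rewrite (card_uniqP _) ?map_inj_in_uniq //.
rewrite size_map card_tuple card_sum card_prod card_ord.
by rewrite mulnn.
Qed.

Lemma count_toptrees_exp (Sigma : finType) (s : seq (toptree Sigma)) k :
  1 < #|Sigma| -> uniq s -> all (fun c => cluster_size c <= k) s ->
  size s <= #|Sigma| ^ (8 * k).
Proof.
move=> S2 us sk; apply: leq_trans (count_toptrees us sk) _.
(* The base is raised by [x ^ 2 + 5 <= x ^ 4] for [x >= 2]. *)
rewrite (_ : 8 * k = 4 * (2 * k)) ?expnM; last by lia.
by case: k {sk} => [//|k]; rewrite leq_exp2r //; nia.
Qed.

Lemma size_subtrees S (tt : toptree S) :
  size (subtrees tt) < 2 * cluster_size tt.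
Proof. by elim: tt => //= m l IHl r IHr; rewrite size_cat; lia. Qed.

Lemma count_subtrees_big S (c : toptree S) k : cluster_size c <= k ->
  count (fun c' => k < cluster_size c') (subtrees c) = 0.
Proof.
elim: c => [e|m l IHl r IHr] /= ck; first by rewrite ltnNge ck.
by rewrite count_cat IHl ?IHr; lia.
Qed.

(** Large subtrees are counted with repetition, small ones up to isomorphism. *)
Lemma topdag_split (Sigma : finType) (tt : toptree Sigma) k : 1 < #|Sigma| ->
  topdag_size tt
    <= count (fun c => k < cluster_size c) (subtrees tt) + #|Sigma| ^ (8 * k).
Proof.
move=> S2; rewrite /topdag_size.
set P := fun c => _; rewrite -(count_predC P (undup _)) leq_add ?count_undup //.
rewrite -size_filter count_toptrees_exp ?filter_uniq ?undup_uniq //.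
by apply/allP => c; rewrite mem_filter /= /P -leqNgt => /andP[].
Qed.

(** * Size of the top DAG *)

Section TopDag.

Variables (R : realFieldType) (Sigma : finType) (T : tree Sigma).
Let alpha : R := (10 / 9)%R.
Notation state t := (modified_state alpha T t).
Notation n := (nb_nodes T).
Variable tt : toptree Sigma.
Hypothesis topT : modified_top_tree alpha T tt.

Lemma topdag_size_le2 : topdag_size tt <= 2 * n.
Proof.
have [t Et] := topT; have := state_size alpha T t; rewrite Et /= !addn0 => H.
apply: leq_trans (size_undup _) (leq_trans (ltnW (size_subtrees tt)) _).
by rewrite leq_mul2l ltnW.
Qed.

Lemma topdag_size_state t k : 1 < #|Sigma| ->
  (2 * alpha ^+ t <= k%:R)%R ->
  topdag_size tt <= cweight (fun=> 1) (state t) + #|Sigma| ^ (8 * k).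
Proof.
move=> S2 tk; apply: leq_trans (topdag_split _ k S2) _; rewrite leq_add2r.
have [t1 Et1] := topT.
(* The added unit makes [f] subadditive: a merge creates at most one large subtree and loses one
   cluster. *)
pose f (c : toptree Sigma) :=
  (count (fun c' => k < cluster_size c') (subtrees c)).+1.
have fM m l r : f (TMerge m l r) <= f l + f r.
  by rewrite /f /= count_cat; case: (k < _) => /=; lia.
(* After iteration [t] no cluster is larger than [k], so [f] is 1 on all of them. *)
apply: leq_trans (_ : cweight f (state t) <= _); last first.
  apply: cweight_leq (big_state T (alpha_ge1 R) t) => c /eqP.
  rewrite eqb0 negbK => ck; rewrite /f count_subtrees_big //.
  by rewrite -(ler_nat R) (le_trans ck).
(* The stopping time [t1] may precede [t]; by stability the final tree can be read at [t + t1]. *)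
apply: leq_trans (state_subadd_le alpha T t t1 fM).
by rewrite addnC (state_stable _ Et1) /= /f; lia.
Qed.

End TopDag.

Lemma topdag_size_log (R : realType) (Sigma : finType) (T : tree Sigma)
    (tt : toptree Sigma) (n := nb_nodes T) (l := trunc_log #|Sigma| n) :
  1 < #|Sigma| -> 1 < n -> modified_top_tree (10 / 9 : R)%R T tt ->
  topdag_size tt * l.+1 <= 2000 * n.
Proof.
move=> S2 n2 topT.
(* Below 32 the bound [2 * n] suffices; otherwise [k >= 2], which makes [t = 0] admissible below. *)
have [l32|l32] := ltnP l 32.
  by have := topdag_size_le2 topT; rewrite -/n; nia.
pose k := l %/ 16.
have k2 : 1 < k by rewrite /k; lia.
(* The last [t] with [2 * alpha ^+ t <= k]; one more factor 10/9 exceeds [k]. *)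
have [t [tk kt]] : exists t, (2 * (10 / 9 : R) ^+ t <= k%:R /\
    k%:R <= 20 / 9 * (10 / 9 : R) ^+ t)%R.
  have ex : exists t, (k%:R < 2 * (10 / 9 : R) ^+ t)%R.
    exists (9 * k); have := alpha_expr_ge R (9 * k); rewrite natrM.
    by have := ler0n R k; lra.
  case: (ex_minnP ex) => [[|t]] kt tmin.
    by move: kt; rewrite expr0 mulr1 ltr_nat; lia.
  exists t; split; last by move: kt; rewrite exprS; lra.
  by rewrite leNgt; apply/negP => /tmin; lia.
have := topdag_size_state topT S2 tk.
set m := cweight _ _; set D := _ ^ _ => dag.
(* Here [80 = 36 * 20 / 9]. *)
have mk : m * k <= 80 * n + k.
  have := nb_clusters_bound R T t; rewrite -/m -/n; case: (m) => [//|m'].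
  rewrite mulSn addnC leq_add2r -(ler_nat R) !natrM -natr1 mulrDl mul1r lerD2r.
  by move: kt; have := ler0n R m'; move: (_ ^+ _)%R => a; nra.
have DD : D ^ 2 <= n.
  rewrite /D -expnM; apply: leq_trans (trunc_logP S2 (ltnW n2)).
  by rewrite leq_exp2l // /l -/l; lia.
have Dk : k < D.
  apply: leq_trans (ltn_expl k S2) _; rewrite /D leq_exp2l //; lia.
have lk : l.+1 <= 16 * k.+1 by rewrite /k; lia.
(* As [k >= 2], [l.+1 <= 24 * k], so the [m] part is at most [24 * (80 * n + k)]; as [k < D], the
   [D] part is at most [16 * D ^ 2 <= 16 * n]. *)
nia.
Qed.

Local Open Scope ring_scope.

Theorem theorem3 (R : realType) :
  exists C : R, 0 < C /\
    forall (Sigma : finType) (T : tree Sigma) (sigma n : nat),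
      #|Sigma| = sigma -> nb_nodes T = n ->
      (1 < sigma)%N -> (1 < n)%N ->
      (exists tt : toptree Sigma, modified_top_tree (10 / 9 : R) T tt) /\
      (forall tt : toptree Sigma, modified_top_tree (10 / 9 : R) T tt ->
         (topdag_size tt)%:R <= C * (n%:R / logb sigma%:R n%:R)).
Proof.
exists 2000; split=> // Sigma T _ _ <- <- S2 n2; split.
  exact: modified_terminates.
move=> tt topT; have := topdag_size_log S2 n2 topT.
set n := nb_nodes T; set l := trunc_log _ _ => H.
have lnS : 0 < ln (#|Sigma|%:R : R) by rewrite ln_gt0 // ltr1n.
have lnn : 0 < ln (n%:R : R) by rewrite ln_gt0 // ltr1n.
(* Rounding up to [l.+1] makes the truncated logarithm dominate the real one. *)
have logl : logb #|Sigma|%:R n%:R <= l.+1%:R :> R.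
  rewrite /logb ler_pdivrMr // mulr_natl -lnXn ?ltr0n ?(ltnW S2) //.
  rewrite ler_ln ?posrE ?exprn_gt0 ?ltr0n ?(ltnW S2) ?(ltnW n2) //.
  by rewrite -natrX ler_nat ltnW // trunc_log_ltn.
have log0 : 0 < logb #|Sigma|%:R n%:R :> R by rewrite divr_gt0.
rewrite mulrA ler_pdivlMr //.
apply: le_trans (_ : (topdag_size tt * l.+1)%:R <= _); last first.
  by rewrite -natrM ler_nat.
by rewrite natrM ler_wpM2l.
Qed.
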